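(* Let $s^{(0)}\in\mathcal{X}$ and $u^{(0)}\in\mathcal{U}$. Let $\tau\in(0,2/\beta)$ and $\sigma>0$ be such that $\sigma\tau\|L\|^2<1$. Let $(\rho^{(i)})_{i\in\mathbb{N}}$ be a sequence in $[0,2]$ such that $\sum_{i\in\mathbb{N}}\rho^{(i)}(2-\rho^{(i)})=+\infty$. Let the sequences be defined, for $i=0,1,\ldots$, either by (form I) $$\begin{aligned}x^{(i+\frac12)}&=\mathrm{prox}_{\tau f}\big(s^{(i)}-\tfrac{\tau}{2}Qs^{(i)}-\tau c\big),\\ u^{(i+\frac12)}&=\mathrm{prox}_{\sigma g^*}\Big(u^{(i)}+\sigma L\big(2x^{(i+\frac12)}-s^{(i)}-\tfrac{\tau}{2}Q(2x^{(i+\frac12)}-s^{(i)})-\tau L^*u^{(i)}\big)\Big),\\ s^{(i+\frac12)}&=x^{(i+\frac12)}-\tfrac{\tau}{2}Q(2x^{(i+\frac12)}-s^{(i)})-\tau L^*u^{(i+\frac12)},\\ s^{(i+1)}&=s^{(i)}+\rho^{(i)}(s^{(i+\frac12)}-s^{(i)}),\\ u^{(i+1)}&=u^{(i)}+\rho^{(i)}(u^{(i+\frac12)}-u^{(i)}),\end{aligned}$$ or by (form II) $$\begin{aligned}u^{(i+\frac12)}&=\mathrm{prox}_{\sigma g^*}\Big(u^{(i)}+\sigma L\big(s^{(i)}-\tfrac{\tau}{2}Qs^{(i)}-\tau L^*u^{(i)}\big)\Big),\\ y^{(i+\frac12)}&=s^{(i)}-\tfrac{\tau}{2}Qs^{(i)}-\tau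 L^*u^{(i+\frac12)},\\ x^{(i+\frac12)}&=\mathrm{prox}_{\tau f}\big(2y^{(i+\frac12)}-s^{(i)}-\tfrac{\tau}{2}Q(2y^{(i+\frac12)}-s^{(i)})-\tau c\big),\\ s^{(i+1)}&=s^{(i)}+\rho^{(i)}(x^{(i+\frac12)}-y^{(i+\frac12)}),\\ u^{(i+1)}&=u^{(i)}+\rho^{(i)}(u^{(i+\frac12)}-u^{(i)}).\end{aligned}$$ Then, in either case, $(x^{(i+\frac12)})_{i\in\mathbb{N}}$ converges weakly to a solution of the primal problem of minimizing $f(x)+g(Lx)+h(x)$ over $x\in\mathcal{X}$, and $(u^{(i)})_{i\in\mathbb{N}}$ converges weakly to a solution of the dual problem of minimizing $(f+h)^*(-L^*u)+g^*(u)$ over $u\in\mathcal{U}$.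
   Context: $\mathcal{X}$ and $\mathcal{U}$ are real Hilbert spaces. For a real Hilbert space $\mathcal{H}$, $\Gamma_0(\mathcal{H})$ is the set of convex, proper, lower semicontinuous functions from $\mathcal{H}$ to $\mathbb{R}\cup\{+\infty\}$; for $\varphi\in\Gamma_0(\mathcal{H})$, $\varphi^*(y)=\sup_{x\in\mathcal{H}}(\langle x,y\rangle-\varphi(x))$ is its conjugate, $\partial\varphi$ its subdifferential, and $\mathrm{prox}_{\varphi}(x)=\operatorname{arg\,min}_{x'\in\mathcal{H}}(\varphi(x')+\frac12\|x'-x\|^2)$. Here $f\in\Gamma_0(\mathcal{X})$, $g\in\Gamma_0(\mathcal{U})$, and $L:\mathcal{X}\to\mathcal{U}$ is a bounded linear operator with adjoint $L^*$. The function $h$ is quadratic: $h(x)=\frac12\langle x,Qx\rangle+\langle x,c\rangle$, where $Q$ is a self-adjoint, positive (i.e. $\langle x,Qx\rangle\ge 0$ for all $x$), nonzero, bounded linear operator on $\mathcal{X}$ and $c\in\mathcal{X}$; $\beta=\|Q\|$. Standing assumption: there exists $x\in\mathcal{X}$ with $0\in\partial f(x)+L^*\partial g(Lx)+\nabla h(x)$. *)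

(* Defs.v *)
From HB Require Import structures.
From mathcomp Require Import all_boot all_order all_algebra.
From mathcomp Require Import all_classical all_reals all_analysis.

Set Implicit Arguments.
Unset Strict Implicit.
Unset Printing Implicit Defensive.

Import Order.TTheory GRing.Theory Num.Theory.
Import numFieldNormedType.Exports.

Local Open Scope classical_set_scope.
Local Open Scope ring_scope.

(* Right linearity and positive definiteness follow from the three fields. *)
HB.mixin Record isInnerProduct (R : realType) X of NormedModule R X := {
  inner : X -> X -> R;
  innerC : forall x y, inner x y = inner y x;
  innerDZl : forall a x y z, inner (a *: x + y) z = a * inner x z + inner y z;
  normE_inner : forall x : X, `|x| ^+ 2 = inner x x
}.

#[short(type="hilbertType")]
HB.structure Definition Hilbert (R : realType) :=
  {X of CompleteNormedModule R X & isInnerProduct R X}.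

Section hilbert.
Context {R : realType}.

(* Supremum over the closed unit ball; finite when A is linear and
   continuous. *)
Definition opnorm (X Y : normedModType R) (A : X -> Y) : R :=
  sup [set `|A x| | x in [set x : X | `|x| <= 1]].

Definition is_adjoint (X Y : hilbertType R) (A : X -> Y) (B : Y -> X) : Prop :=
  forall x y, inner (A x) y = inner x (B y).

Definition weak_cvg (X : hilbertType R) (x : nat -> X) (l : X) : Prop :=
  forall y, inner (x n) y @[n --> \oo] --> inner l y.

Definition is_gradient (X : hilbertType R) (h : X -> R^o) (x v : X) : Prop :=
  is_diff x h (inner v : X -> R^o).

Local Open Scope ereal_scope.

Definition argmin (T : Type) (phi : T -> \bar R) : set T :=
  [set x | forall y, phi x <= phi y].

Definition convex_ereal (X : lmodType R) (phi : X -> \bar R) : Prop :=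
  forall (x y : X) (t : R), (0 < t < 1)%R ->
    phi (t *: x + (1 - t) *: y)%R <= t%:E * phi x + (1 - t)%:E * phi y.

Definition proper (T : Type) (phi : T -> \bar R) : Prop :=
  (forall x, phi x != -oo) /\ (exists x, phi x != +oo).

Definition Gamma0 (X : hilbertType R) : set (X -> \bar R) :=
  [set phi | [/\ convex_ereal phi, proper phi & lower_semicontinuous phi]].

Definition conjugate (X : hilbertType R) (phi : X -> \bar R) (y : X) : \bar R :=
  ereal_sup [set (inner x y)%:E - phi x | x in [set: X]].

Definition subdiff (X : hilbertType R) (phi : X -> \bar R) (x : X) : set X :=
  [set v | forall y, phi x + (inner (y - x) v)%:E <= phi y].

(* The argmin is a singleton for phi in Gamma0; the value 0 is only a default
   outside that class. *)
Definition prox (X : hilbertType R) (phi : X -> \bar R) (x : X) : X :=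
  xget 0%R (argmin (fun x' => phi x' + (2^-1 * `|x' - x| ^+ 2)%:E)).

End hilbert.

Section algorithm.
Context {R : realType} (X U : hilbertType R).
Variables (f : X -> \bar R) (g : U -> \bar R).
Variables (L : X -> U) (Ladj : U -> X) (Q : X -> X) (c : X).

Definition quadratic (x : X) : R := 2^-1 * inner x (Q x) + inner x c.

Definition primal (x : X) : \bar R := (f x + g (L x) + (quadratic x)%:E)%E.

Definition dual (u : U) : \bar R :=
  (conjugate (fun x => f x + (quadratic x)%:E) (- Ladj u)%R + conjugate g u)%E.

Variables (tau sigma : R) (rho : nat -> R).

Let prox_f := prox (fun x => (tau%:E * f x)%E).
Let prox_gstar := prox (fun u => (sigma%:E * conjugate g u)%E).

(* In both forms xh, uh, sh, yh at index i stand for the iterates with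
   superscript i + 1/2. *)
Definition formI (s xh sh : nat -> X) (u uh : nat -> U) : Prop :=
  forall i,
  [/\ xh i = prox_f (s i - (tau / 2) *: Q (s i) - tau *: c),
      uh i = prox_gstar
        (u i + sigma *: L (2 *: xh i - s i
                           - (tau / 2) *: Q (2 *: xh i - s i)
                           - tau *: Ladj (u i))),
      sh i = xh i - (tau / 2) *: Q (2 *: xh i - s i) - tau *: Ladj (uh i),
      s i.+1 = s i + rho i *: (sh i - s i)
    & u i.+1 = u i + rho i *: (uh i - u i)].

Definition formII (s xh yh : nat -> X) (u uh : nat -> U) : Prop :=
  forall i,
  [/\ uh i = prox_gstar
        (u i + sigma *: L (s i - (tau / 2) *: Q (s i) - tau *: Ladj (u i))),
      yh i = s i - (tau / 2) *: Q (s i) - tau *: Ladj (uh i),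
      xh i = prox_f
        (2 *: yh i - s i - (tau / 2) *: Q (2 *: yh i - s i) - tau *: c),
      s i.+1 = s i + rho i *: (xh i - yh i)
    & u i.+1 = u i + rho i *: (uh i - u i)].

End algorithm.

(* Main.v *)
Require Import Defs.
From HB Require Import structures.
From mathcomp Require Import all_boot all_order all_algebra.
From mathcomp Require Import all_classical all_reals all_analysis.
From mathcomp Require Import ring lra.

Set Implicit Arguments.
Unset Strict Implicit.
Unset Printing Implicit Defensive.

Import Order.TTheory GRing.Theory Num.Theory.
Import numFieldNormedType.Exports.

Local Open Scope classical_set_scope.
Local Open Scope ring_scope.

(** Put M = (tau/2) Q, K = tau L^*, kappa = tau/sigma. Both algorithms are
    relaxed iterations z' = z + rho (T z - z) of a map T on pairs z = (s, u),
    and everything takes place in the metric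
      W (z, z') = <s, (I - M) s'> + kappa <u, u'> - <K u, K u'>,
    which is coercive because tau |Q| < 2 and sigma tau |L|^2 < 1.

    The reason for the theorem is that T is firmly nonexpansive for W. The
    quadratic term is split in two halves: one joins f, the other joins the
    composite term, and T is then the Douglas-Rachford operator of the two
    resulting monotone operators, preconditioned by I - M, with the resolvent
    of the composite term itself computed through the dual variable. Adding the
    monotonicity inequalities of the two proximity operators gives, for
    differences of two inputs and of the corresponding outputs, the energy
    inequality
      <dx, M dx> + <dy, M dy> <= W (dz', dz - dz'),
    where x and y are the two half-step points. Its left-hand side is
    nonnegative, so T is firmly nonexpansive. [energy_primal_first] keeps the
    term in x, used below, for form I; [energy_dual_first] is the positivity
    statement for form II.

    The Krasnoselskii-Mann theorem ([krasnoselskii_mann]) then yields weak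
    convergence of (s, u) to a fixed point and T z - z -> 0 in the metric. Fixed
    points correspond to pairs (x, u) satisfying the optimality system
    ([saddle]), whose components minimize the primal and the dual problem
    ([primal_optimal], [dual_optimal]).

    Since proximity operators are not weakly continuous, the convergence of the
    half-step points x needs a further argument. In form II, x - y -> 0 and y
    is a continuous affine function of s and of the new u. In form I, the energy
    inequality at the limit point forces <dx, M dx> -> 0, hence M dx tends to 0
    weakly by Cauchy-Schwarz for the form of M; the update formula of s then
    writes dx as a sum of terms that all tend to 0 weakly
    ([primal_first_cvg]).

    The Hilbert space theory is built from a single existence result,
    [subdiff_surjective] (Minty's theorem for subdifferentials): it provides the
    proximity operators of f and, by Moreau's decomposition, those of g^*, and
    it implies the Riesz theorem, from which weak compactness of balls
    follows. *)

(** * Positive semidefinite forms and inner products *)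

(** Forms are unbundled from the vector space because the same space X * U is
    studied with a metric that depends on the parameters of the algorithm. *)
Definition psd_form (R : realType) (H : lmodType R) (w : H -> H -> R) : Prop :=
  [/\ forall x y, w x y = w y x,
      forall a x y z, w (a *: x + y) z = a * w x z + w y z
    & forall x, 0 <= w x x].

Section psd_form_theory.
Context {R : realType} {H : lmodType R} {w : H -> H -> R} (hw : psd_form w).

Lemma formC x y : w x y = w y x. Proof. by case: hw. Qed.

Lemma form_ge0 x : 0 <= w x x. Proof. by case: hw. Qed.

Lemma formDl x y z : w (x + y) z = w x z + w y z.
Proof. by case: hw => _ h _; have := h 1 x y z; rewrite scale1r mul1r. Qed.

Lemma form0l z : w 0 z = 0.
Proof. by have := formDl 0 0 z; rewrite addr0 => h; lra. Qed.

Lemma formZl a x z : w (a *: x) z = a * w x z.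
Proof.
by case: hw => _ h _; have := h a x 0 z; rewrite addr0 form0l addr0.
Qed.

Lemma formNl x z : w (- x) z = - w x z.
Proof. by rewrite -scaleN1r formZl mulN1r. Qed.

Lemma formBl x y z : w (x - y) z = w x z - w y z.
Proof. by rewrite formDl formNl. Qed.

Lemma formDr x y z : w z (x + y) = w z x + w z y.
Proof. by rewrite formC formDl !(formC z). Qed.

Lemma form0r z : w z 0 = 0. Proof. by rewrite formC form0l. Qed.

Lemma formZr a x z : w z (a *: x) = a * w z x.
Proof. by rewrite formC formZl (formC z). Qed.

Lemma formNr x z : w z (- x) = - w z x.
Proof. by rewrite formC formNl (formC z). Qed.

Lemma formBr x y z : w z (x - y) = w z x - w z y.
Proof. by rewrite formDr formNr. Qed.

Definition formE := (formDl, formDr, formNl, formNr, formZl, formZr).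

Lemma form_sqrD x y : w (x + y) (x + y) = w x x + 2 * w x y + w y y.
Proof. by rewrite !formE (formC y x); ring. Qed.

Lemma form_cauchy_schwarz x y : w x y ^+ 2 <= w x x * w y y.
Proof.
have [xy0|xy0] := eqVneq (w x y) 0.
  by rewrite xy0 expr0n /= mulr_ge0// form_ge0.
have [y0|y0] := eqVneq (w y y) 0.
  (* a null direction y makes t |-> w (x + t y) (x + t y) affine, hence
     unbounded below unless w x y = 0 *)
  have := form_ge0 (x - ((w x x + 1) / (2 * w x y)) *: y).
  have neg1 (z : R) : z = -1 -> 0 <= z -> w x y ^+ 2 <= w x x * w y y.
    by move=> ->; rewrite ler0N1.
  by apply: neg1; rewrite !formE y0 (formC y x); field.
have yp : 0 < w y y by rewrite lt_neqAle eq_sym y0 form_ge0.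
rewrite -subr_ge0.
have -> : w x x * w y y - w x y ^+ 2 =
    w y y * w (x - (w x y / w y y) *: y) (x - (w x y / w y y) *: y).
  by rewrite !formE (formC y x); field.
by rewrite mulr_ge0// form_ge0.
Qed.

End psd_form_theory.

Section hilbert_theory.
Context {R : realType} {X : hilbertType R}.
Implicit Types x y z : X.

Lemma inner_form : psd_form (@inner R X).
Proof.
split=> [x y|a x y z|x]; [exact: innerC|exact: innerDZl|].
by rewrite -normE_inner sqr_ge0.
Qed.

Definition innerE := (formDl inner_form, formDr inner_form,
  formNl inner_form, formNr inner_form, formZl inner_form, formZr inner_form).

Lemma inner0_eq0 x : inner x x = 0 -> x = 0.
Proof.
by rewrite -normE_inner => /eqP; rewrite sqrf_eq0 normr_eq0 => /eqP.
Qed.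

Lemma inner_inj x y : (forall z, inner x z = inner y z) -> x = y.
Proof.
move=> h; apply/eqP; rewrite -subr_eq0; apply/eqP/inner0_eq0.
by rewrite (formBl inner_form) h subrr.
Qed.

Lemma inner_le x y : `|inner x y| <= `|x| * `|y|.
Proof.
rewrite -(@ler_pXn2r _ 2)// ?nnegrE ?mulr_ge0//.
rewrite exprMn !normE_inner real_normK ?num_real//.
exact: form_cauchy_schwarz inner_form _ _.
Qed.

End hilbert_theory.

(** * Minty's theorem for subdifferentials *)

Section finite_values.
Context {R : realType} {X : hilbertType R} {phi : X -> \bar R}
  (phi_proper : Defs.proper phi).

Lemma properE y : phi y != +oo%E -> phi y = (fine (phi y))%:E.
Proof.
by move=> yp; rewrite fineK// fin_numE yp andbT; case: phi_proper.
Qed.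

Lemma subdiff_fin p v : subdiff phi p v -> phi p = (fine (phi p))%:E.
Proof.
case: phi_proper => _ [y yoo] /(_ y) h; apply: properE.
by apply: contraNneq yoo => poo; move: h; rewrite poo addye// leye_eq.
Qed.

Lemma subdiff_monotone p q v w : subdiff phi p v -> subdiff phi q w ->
  0 <= inner (p - q) (v - w).
Proof.
move=> pv qw; have := pv q; have := qw p.
rewrite (subdiff_fin pv) (subdiff_fin qw) -!EFinD !lee_fin !innerE.
by move=> h1 h2; lra.
Qed.

End finite_values.

Section minty.
Context {R : realType} {X : hilbertType R} (phi : X -> \bar R).

(** Minimizing sequences of the strongly convex function
    y |-> phi y + k/2 |y - x|^2 are Cauchy, so completeness and lower
    semicontinuity give a minimizer p, whose first-order condition says that
    k (x - p) is a subgradient at p: this is Minty's theorem for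
    subdifferentials. *)
Lemma subdiff_surjective (k b : R) (x : X) : Gamma0 phi -> 0 < k ->
  (forall y, (b%:E <= phi y + (k / 2 * `|y - x| ^+ 2)%:E)%E) ->
  exists p, subdiff phi p (k *: (x - p)).
Proof.
move=> [cvx pr lsc] k0 lb.
pose F y := fine (phi y); pose D y := phi y != +oo%E.
have FE y : D y -> phi y = (F y)%:E by exact: properE.
have cvxF y z t : D y -> D z -> 0 < t < 1 ->
    let c := t *: y + (1 - t) *: z in
    D c /\ F c <= t * F y + (1 - t) * F z.
  move=> Dy Dz t01 /=; have := cvx y z t t01.
  rewrite (FE _ Dy) (FE _ Dz) -!EFinM -EFinD => h.
  have Dc : D (t *: y + (1 - t) *: z).
    by rewrite /D; apply: contraTneq h => ->; rewrite -ltNge ltry.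
  by split => //; move: h; rewrite (FE _ Dc) lee_fin.
pose G y := F y + k / 2 * `|y - x| ^+ 2.
pose S := [set G y | y in [set y | D y]].
have Slb : lbound S b.
  by move=> _ [y Dy <-]; have := lb y; rewrite (FE _ Dy) -EFinD lee_fin.
have S0 : S !=set0 by case: pr => _ [y yD]; exists (G y), y.
have Sinf : has_inf S by split => //; exists b.
pose m := inf S.
have mG y : D y -> m <= G y by move=> Dy; apply: ge_inf; [exists b|exists y].
have /choice[z zP] (n : nat) : exists y, D y /\ G y < m + n.+1%:R^-1.
  have [|_ [y Dy <-] Gy] := @inf_adherent _ S n.+1%:R^-1 _ Sinf.
    by rewrite invr_gt0.
  by exists y.
clearbody m.
(* strong convexity at the midpoint of two points, compared with the infimum *)
have mid y w : D y -> D w ->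
    k / 4 * `|y - w| ^+ 2 <= (G y - m) + (G w - m).
  move=> Dy Dw; have [|Dc Fc] := cvxF y w 2^-1 Dy Dw; first by apply/andP; lra.
  have := mG _ Dc; move: Fc; set c := _ + _ => Fc.
  have E : `|c - x| ^+ 2 = 2^-1 * `|y - x| ^+ 2 + 2^-1 * `|w - x| ^+ 2
      - 4^-1 * `|y - w| ^+ 2.
    rewrite !normE_inner /c !innerE (innerC w y) (innerC x y) (innerC x w).
    by field.
  rewrite /G E => mc; lra.
have zC : cvg (z n @[n --> \oo]).
  apply/cauchy_cvgP/cauchy_exP => e e0.
  have e'0 : 0 < k / 8 * e ^+ 2 by rewrite mulr_gt0 ?exprn_gt0 ?divr_gt0.
  have inv_small := near_infty_natSinv_lt (PosNum e'0).
  have [N NP] := filter_ex inv_small.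
  exists (z N); suff : \forall n \near \oo, ball (z N) e (z n) by [].
  near=> n; rewrite -ball_normE /ball_ /=.
  rewrite -(@ltr_pXn2r _ 2)// ?nnegrE ?(ltW e0)//.
  have [D1 G1] := zP N; have [D2 G2] := zP n.
  have := mid _ _ D1 D2 => h.
  have n2 : n.+1%:R^-1 < k / 8 * e ^+ 2 by near: n; exact: inv_small.
  have n1 : N.+1%:R^-1 < k / 8 * e ^+ 2 := NP.
  have : k / 4 * `|z N - z n| ^+ 2 < k / 4 * e ^+ 2.
    by move: (N.+1%:R^-1) (n.+1%:R^-1) G1 G2 n1 n2 => i j G1 G2 n1 n2; lra.
  by rewrite ltr_pM2l// divr_gt0.
pose p := lim (z n @[n --> \oo]).
have zp : z n @[n --> \oo] --> p by [].
have nzp : `|z n - x| ^+ 2 @[n --> \oo] --> `|p - x| ^+ 2.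
  have h : `|z n - x| @[n --> \oo] --> `|p - x|.
    by apply: cvg_norm; apply: cvgB => //; exact: cvg_cst.
  by rewrite !expr2; under eq_fun do rewrite expr2; exact: cvgM.
have Pp : (phi p <= (m - k / 2 * `|p - x| ^+ 2)%:E)%E.
  rewrite leNgt; apply/negP => lt_p.
  (* a level strictly between the two sides, for lower semicontinuity *)
  have [a lta a_p] : exists2 a : R, m - k / 2 * `|p - x| ^+ 2 < a &
      (a%:E < phi p)%E.
    case E : (phi p) lt_p => [r| |]//.
      rewrite lte_fin => h; exists ((m - k / 2 * `|p - x| ^+ 2 + r) / 2).
        by lra.
      by rewrite lte_fin; lra.
    by move=> _; exists (m - k / 2 * `|p - x| ^+ 2 + 1); [lra|rewrite ltry].
  have [V Vp Va] := lsc p a a_p.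
  have {Vp} Vz : \forall n \near \oo, V (z n) by exact: zp.
  pose d := a - (m - k / 2 * `|p - x| ^+ 2).
  have d0 : 0 < d by rewrite subr_gt0.
  have hz : \forall n \near \oo, k / 2 * `|p - x| ^+ 2 - d / 2
      < k / 2 * `|z n - x| ^+ 2.
    have : k / 2 * `|z n - x| ^+ 2 @[n --> \oo] --> k / 2 * `|p - x| ^+ 2.
      by apply: cvgM => //; exact: cvg_cst.
    by move/cvgr_gt; apply; rewrite ltrBlDr ltrDl divr_gt0.
  have [n [Vn [hn nd]]] : exists n, V (z n) /\ (k / 2 * `|p - x| ^+ 2 - d / 2
      < k / 2 * `|z n - x| ^+ 2 /\ n.+1%:R^-1 < d / 2).
    have d20 : 0 < d / 2 by rewrite divr_gt0.
    near \oo => n; exists n; split; first by near: n.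
    split; first by near: n.
    by near: n; exact: near_infty_natSinv_lt (PosNum d20).
  have [Dn Gn] := zP n; have := Va _ Vn; rewrite (FE _ Dn) lte_fin => aF.
  move: (n.+1%:R^-1) Gn nd; rewrite /G /d => j Gn nd.
  by rewrite /d in d0 hn; lra.
have Dp : D p by rewrite /D; apply: contraTneq Pp => ->; rewrite -ltNge ltry.
exists p => y; have [->|/negPf yoo] := eqVneq (phi y) +oo%E; first by rewrite leey.
have Dy : D y by rewrite /D yoo.
rewrite (FE _ Dp) (FE _ Dy) -EFinD lee_fin.
move: Pp; rewrite (FE _ Dp) lee_fin => Fp.
(* compare p with p + t (y - p), then let t tend to 0 *)
have step t : 0 < t < 1 ->
    F p + inner (y - p) (k *: (x - p)) <= F y + t * (k / 2 * `|y - p| ^+ 2).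
  move=> t01; have [t0 t1] := andP t01; have [Dc Fc] := cvxF y p t Dy Dp t01.
  have := mG _ Dc; move: Fc; set c := _ + _ => Fc.
  have E : `|c - x| ^+ 2 = `|p - x| ^+ 2 + t * (t * `|y - p| ^+ 2
      - 2 * inner (y - p) (x - p)).
    rewrite !normE_inner /c !innerE (innerC p y) (innerC x y) (innerC x p).
    by ring.
  rewrite /G E (formZr inner_form) => mc.
  rewrite -(ler_pM2l t0).
  move: (inner _ _) (`|y - p| ^+ 2) mc => u v mc.
  by lra.
apply/ler_addgt0Pl => e e0.
pose v := k / 2 * `|y - p| ^+ 2.
have v0 : 0 <= v by rewrite mulr_ge0 ?sqr_ge0// divr_ge0// ltW.
have ve : 0 < v + e + 1 by lra.
apply: le_trans (step (e / (v + e + 1)) _) _.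
  by rewrite divr_gt0//= ltr_pdivrMr// mul1r; lra.
rewrite addrC lerD2r -/v mulrAC ler_pdivrMr// ler_pM2l//; lra.
Unshelve. all: by end_near. Qed.

End minty.

(** * Proximity operators and conjugates *)

Section prox_theory.
Context {R : realType} {X : hilbertType R}.
Implicit Types (phi : X -> \bar R) (x y p v w : X).

Lemma subdiff_bounded_below phi (k : R) p v x : Defs.proper phi -> 0 < k ->
  subdiff phi p v ->
  exists b : R, forall y, (b%:E <= phi y + (k / 2 * `|y - x| ^+ 2)%:E)%E.
Proof.
move=> pr k0 pv.
exists (fine (phi p) + inner (x - p) v - (2 * k)^-1 * inner v v) => y.
apply: le_trans (leeD2r _ (pv y)).
rewrite (subdiff_fin pr pv) -!EFinD lee_fin normE_inner -subr_ge0.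
have -> : fine (phi p) + inner (y - p) v + k / 2 * inner (y - x) (y - x) -
    (fine (phi p) + inner (x - p) v - (2 * k)^-1 * inner v v) =
    k / 2 * inner (y - x + k^-1 *: v) (y - x + k^-1 *: v).
  rewrite !innerE (innerC x y) (innerC v y) (innerC v x); field.
  by rewrite gt_eqF.
by rewrite mulr_ge0 ?divr_ge0 ?(ltW k0)// (form_ge0 inner_form).
Qed.

(** A subgradient at one point is an affine minorant, which bounds the
    proximal objective from below. *)
Lemma exists_resolvent phi p0 v0 (k : R) x : Gamma0 phi ->
  subdiff phi p0 v0 -> 0 < k -> exists p, subdiff phi p (k *: (x - p)).
Proof.
move=> G0 pv0 k0; have [_ pr _] := G0.
have [b bP] := subdiff_bounded_below x pr k0 pv0.
exact: subdiff_surjective G0 k0 bP.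
Qed.

(** The subgradient inequality makes p a strict minimizer of the proximal
    objective, with the gap |y - p|^2 / 2. *)
Lemma proxE phi (t : R) x p : phi p = (fine (phi p))%:E -> 0 < t ->
  subdiff phi p (t^-1 *: (x - p)) -> prox (fun y => t%:E * phi y)%E x = p.
Proof.
move=> pfin t0 pv; have tn0 : t != 0 by rewrite gt_eqF.
have lb y (r : R) : phi y = r%:E ->
    t * fine (phi p) + 2^-1 * `|p - x| ^+ 2 + 2^-1 * `|y - p| ^+ 2
    <= t * r + 2^-1 * `|y - x| ^+ 2.
  move=> yr; have := pv y.
  rewrite yr pfin -EFinD lee_fin -(ler_pM2l t0) (formZr inner_form).
  rewrite mulrDr mulrA divff// mul1r.
  rewrite !normE_inner !innerE (innerC x p) (innerC p y) (innerC x y).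
  by lra.
have sq0 (y : X) : 0 <= `|y - p| ^+ 2 by rewrite sqr_ge0.
have ninfty y : phi y <> -oo%E.
  by move=> yoo; have := pv y; rewrite yoo pfin -EFinD.
apply: xget_unique => [y|y ymin].
  case E : (phi y) => [r| |]; last by case: (ninfty _ E).
    rewrite pfin -!EFinM -!EFinD lee_fin.
    by have := lb _ _ E; have := sq0 y; lra.
  by rewrite gt0_muley ?lte_fin// addye// leey.
have := ymin p; case E : (phi y) => [r| |]; last by case: (ninfty _ E).
  rewrite pfin -!EFinM -!EFinD lee_fin => h.
  have {}h : `|y - p| ^+ 2 = 0.
    by apply/eqP; rewrite eq_le sq0 andbT; have := lb _ _ E; lra.
  by apply/eqP; rewrite -subr_eq0 -normr_eq0 -sqrf_eq0 h.
by rewrite pfin gt0_muley ?lte_fin// addye// -EFinM -EFinD leye_eq.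
Qed.

Lemma prox_subdiff phi p0 v0 (t : R) x : Gamma0 phi -> subdiff phi p0 v0 ->
  0 < t ->
  let p := prox (fun y => t%:E * phi y)%E x in subdiff phi p (t^-1 *: (x - p)).
Proof.
move=> G0 pv0 t0; have [_ pr _] := G0.
have ti0 : 0 < t^-1 by rewrite invr_gt0.
have [p pv] := exists_resolvent x G0 pv0 ti0.
by rewrite /= (proxE (subdiff_fin pr pv) t0 pv).
Qed.

Lemma prox_eq phi (t : R) p v : Defs.proper phi -> 0 < t -> subdiff phi p v ->
  prox (fun y => t%:E * phi y)%E (p + t *: v) = p.
Proof.
move=> pr t0 pv; apply: (proxE (subdiff_fin pr pv)) => //.
by rewrite addrC addKr scalerA mulVf ?scale1r// gt_eqF.
Qed.

Lemma conjugate_ge phi p u : ((inner p u)%:E - phi p <= conjugate phi u)%E.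
Proof. by apply: ereal_sup_ubound; exists p. Qed.

Lemma conjugateE phi p v : phi p = (fine (phi p))%:E -> subdiff phi p v ->
  conjugate phi v = (inner p v - fine (phi p))%:E.
Proof.
move=> pfin pv; apply/eqP; rewrite eq_le; apply/andP; split; last first.
  by have := conjugate_ge phi p v; rewrite {1}pfin -EFinD.
apply: ge_ereal_sup => _ [y _ <-]; have := pv y; rewrite pfin.
case: (phi y) => [r| |]; rewrite -?EFinD ?lee_fin//=; last first.
  by move=> _; rewrite leNye.
by rewrite !innerE => h; lra.
Qed.

Lemma subdiff_conjugate phi p v : phi p = (fine (phi p))%:E ->
  subdiff phi p v -> subdiff (conjugate phi) v p.
Proof.
move=> pfin pv w; rewrite (conjugateE pfin pv) -EFinD.
apply: le_trans (conjugate_ge phi p w); rewrite pfin -EFinD lee_fin.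
by rewrite !innerE (innerC v p) (innerC w p); lra.
Qed.

Lemma prox_conjugateE phi (t : R) p v : Defs.proper phi -> 0 < t ->
  subdiff phi p v ->
  prox (fun u => t%:E * conjugate phi u)%E (v + t *: p) = v.
Proof.
move=> pr t0 pv; have pfin := subdiff_fin pr pv.
apply: (proxE (phi := conjugate phi)) => //; first by rewrite (conjugateE pfin pv).
rewrite addrC addKr scalerA mulVf ?gt_eqF// scale1r.
exact: subdiff_conjugate.
Qed.

(** Moreau's decomposition: p, the point of the resolvent of phi at x / t with
    parameter 1 / t, satisfies v = x - t p. Having constructed v from p gives a
    subgradient of phi rather than one of its conjugate. *)
Lemma prox_conjugate_subdiff phi p0 v0 (t : R) x : Gamma0 phi ->
  subdiff phi p0 v0 -> 0 < t ->
  let v := prox (fun u => t%:E * conjugate phi u)%E x in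
  subdiff phi (t^-1 *: (x - v)) v.
Proof.
move=> G0 pv0 t0; have [_ pr _] := G0.
have [p] := exists_resolvent (t^-1 *: x) G0 pv0 t0.
rewrite scalerBr scalerA divff ?gt_eqF// scale1r => pv.
have := prox_conjugateE pr t0 pv; rewrite subrK => /= ->.
by rewrite opprB addrC subrK scalerA mulVf ?gt_eqF// scale1r.
Qed.

End prox_theory.

(** * Bounded operators and weak compactness *)

Section bounded_operators.
Context {R : realType}.

Lemma opnorm_ge (X Y : normedModType R) (A : {linear X -> Y}) x :
  continuous A -> `|A x| <= opnorm A * `|x|.
Proof.
move=> /linear_bounded_continuous/linear_boundedP/pinfty_ex_gt0 [M M0 AM].
have [->|x0] := eqVneq x 0; first by rewrite linear0 !normr0 mulr0.
have nx0 : 0 < `|x| by rewrite normr_gt0.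
rewrite -ler_pdivrMr//.
have -> : `|A x| / `|x| = `|A (`|x|^-1 *: x)|.
  by rewrite linearZ/= normrZ ger0_norm ?invr_ge0// mulrC.
apply: ub_le_sup.
  exists M => _ [y /= y1 <-]; apply: le_trans (AM y) _.
  by rewrite ler_piMr// ltW.
exists (`|x|^-1 *: x) => //=.
by rewrite normrZ ger0_norm ?invr_ge0// mulVf// gt_eqF.
Qed.

Lemma opnorm_ge0 (X Y : normedModType R) (A : {linear X -> Y}) :
  continuous A -> 0 <= opnorm A.
Proof.
move=> /linear_bounded_continuous/linear_boundedP/pinfty_ex_gt0 [M M0 AM].
apply: (@le_trans _ _ `|A 0|); first by [].
apply: ub_le_sup; last by exists 0 => //=; rewrite normr0.
exists M => _ [y /= y1 <-]; apply: le_trans (AM y) _.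
by rewrite ler_piMr// ltW.
Qed.

(** A solution of x - N x = a is a fixed point of the contraction
    x |-> a + N x. *)
Lemma id_sub_surjective (X : hilbertType R) (N : {linear X -> X}) (q : R) a :
  0 <= q < 1 -> (forall x, `|N x| <= q * `|x|) -> exists x, x - N x = a.
Proof.
move=> /andP[q0 q1] Nq.
pose T : {fun [set: X] >-> [set: X]} := totalfun (fun x => a + N x).
have cT : is_contraction T.
  exists (NngNum q0); split => //= -[x y] _ /=.
  by rewrite /totalfun_ opprD addrACA subrr add0r -linearB; exact: Nq.
have [||x _ xE] := banach_fixed_point cT.
- exact: closedT.
- by exists 0.
by exists x; rewrite {1}xE /= /totalfun_ addrK.
Qed.

Lemma adjoint_linear (X Y : hilbertType R) (A : {linear X -> Y}) B :
  is_adjoint A B -> linear B.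
Proof.
move=> AB a x y; apply: inner_inj => z.
by rewrite innerC -AB !innerE !AB !(innerC z).
Qed.

Lemma adjoint_le (X Y : hilbertType R) (A : {linear X -> Y}) B (q : R) y :
  is_adjoint A B -> 0 <= q -> (forall x, `|A x| <= q * `|x|) ->
  `|B y| <= q * `|y|.
Proof.
move=> AB q0 Aq; have [->|B0] := eqVneq (B y) 0.
  by rewrite normr0 mulr_ge0.
rewrite -(@ler_pM2l _ `|B y|) ?normr_gt0// -expr2 normE_inner -AB.
apply: le_trans (ler_norm _) _; apply: le_trans (inner_le _ _) _.
by rewrite mulrCA mulrA ler_wpM2r.
Qed.

End bounded_operators.

Section weak_compactness.
Context {R : realType}.

(** Minty's theorem for the convex function - l and the point 0 gives p such
    that - p is a subgradient of - l at p. This means l d <= <p, d> for all d,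
    and replacing d by - d turns the inequality into an equality. *)
Lemma riesz (X : hilbertType R) (l : X -> R) (M : R) :
  (forall a x y, l (a *: x + y) = a * l x + l y) ->
  (forall x, `|l x| <= M * `|x|) -> exists p, forall y, l y = inner p y.
Proof.
move=> lin lM.
have lD x y : l (x + y) = l x + l y by rewrite -[x]scale1r lin mul1r scale1r.
have l0 : l 0 = 0 by have := lD 0 0; rewrite addr0 => h; lra.
have lZ a x : l (a *: x) = a * l x by rewrite -[a *: x]addr0 lin l0 addr0.
have lN x : l (- x) = - l x by rewrite -scaleN1r lZ mulN1r.
have G0 : Gamma0 (fun x => (- l x)%:E).
  split.
  - by move=> x y t _; rewrite -!EFinM -EFinD lee_fin lD !lZ; lra.
  - by split => //; exists 0.
  - move=> x a; rewrite lte_fin => ax.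
    have M1 : 0 < `|M| + 1 by rewrite ltr_wpDl.
    have r0 : 0 < (- l x - a) / (`|M| + 1) by rewrite divr_gt0// subr_gt0.
    exists (ball x ((- l x - a) / (`|M| + 1))); first exact: nbhsx_ballx.
    move=> y; rewrite -ball_normE /ball_ /= ltr_pdivlMr// => xy.
    rewrite lte_fin; have := lM (x - y); rewrite lD lN.
    have : M * `|x - y| <= `|x - y| * (`|M| + 1).
      by rewrite mulrC ler_wpM2l//; have := ler_norm M; lra.
    by have := ler_norm (- (l x - l y)); rewrite normrN; lra.
have [|p pP] := @subdiff_surjective _ _ _ 1 (- (M ^+ 2 / 2)) 0 G0 ltr01.
  move=> y; rewrite -EFinD lee_fin subr0.
  have := lM y; have := ler_norm (l y); have := sqr_ge0 (M - `|y|).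
  by rewrite sqrrB; lra.
have ineq d : l d <= inner p d.
  have := pP (p + d); rewrite -EFinD lee_fin lD scale1r sub0r (addrC p d) addrK.
  by rewrite !innerE (innerC d p); lra.
exists p => y; apply/eqP; rewrite eq_le ineq /=.
by have := ineq (- y); rewrite lN innerE; lra.
Qed.

Lemma ultra_bounded_cvg (G : set_system nat) (a : nat -> R) (B : R) :
  UltraFilter G -> (forall n, `|a n| <= B) -> cvg (a n @[n --> G]).
Proof.
move=> GU aB.
have UG : UltraFilter (a n @[n --> G]).
  split; first exact: fmap_proper_filter.
  move=> H HF GH; rewrite eqEsubset; split => // S HS.
  have [//|nS] := in_ultra_setVsetC (a @^-1` S) GU.
  have : H (S `&` ~` S) by apply: filterI => //; exact: GH.
  by rewrite setICr => /filter_not_empty.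
have := @segment_compact R (- B) B; rewrite compact_ultra.
move=> /(_ _ UG) [|l [_ al]]; last by apply/cvg_ex; exists l.
have aI n : a n \in `[- B, B] by rewrite in_itv /= -ler_norml.
exact: (@filterE _ G _ _ aI).
Qed.

(** Weak sequential compactness of balls for the form w, stated with
    ultrafilters so that no subsequence has to be extracted. *)
Definition weakly_complete (H : lmodType R) (w : H -> H -> R) : Prop :=
  forall (z : nat -> H) (B : R) (G : set_system nat), UltraFilter G ->
  (forall n, w (z n) (z n) <= B) ->
  exists l, forall y, w (z n) y @[n --> G] --> w l y.

(** The limits of the bounded real sequences <z_n, y> along the ultrafilter
    define a bounded linear functional of y, represented by Riesz. *)
Lemma inner_weakly_complete (X : hilbertType R) : weakly_complete (@inner R X).
Proof.
move=> z B G GU zB.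
have zn n : `|z n| <= B + 1.
  have := zB n; rewrite -normE_inner; have := sqr_ge0 (`|z n| - 1).
  by rewrite sqrrB; have := normr_ge0 (z n); lra.
have bnd n y : `|inner (z n) y| <= (B + 1) * `|y|.
  by apply: le_trans (inner_le _ _) _; rewrite ler_wpM2r.
have cv y : cvg (inner (z n) y @[n --> G]).
  by apply: ultra_bounded_cvg => n; exact: bnd.
pose l y := lim (inner (z n) y @[n --> G]).
have cvl y : inner (z n) y @[n --> G] --> l y by exact: cv.
have [a x y|x|p pE] := @riesz X l (B + 1).
- apply: cvg_lim => //.
  under eq_fun do rewrite !innerE.
  by apply: cvgD; [apply: cvgM; [exact: cvg_cst|exact: cvl]|exact: cvl].
- have nl : `|inner (z n) x| @[n --> G] --> `|l x| by apply: cvg_norm; exact: cvl.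
  by apply: (cvgr_to_le nl); apply: filterE => n; exact: bnd.
by exists p => y; rewrite -pE; exact: cvl.
Qed.

Lemma coercive_weakly_complete (X : hilbertType R) (w : X -> X -> R)
    (S : X -> X) (c : R) : (forall x y, w x y = inner x (S y)) -> 0 < c ->
  (forall x, c * `|x| ^+ 2 <= w x x) -> weakly_complete w.
Proof.
move=> wS c0 cw z B G GU zB.
have [|l lP] := @inner_weakly_complete X z (B / c) G GU.
  move=> n; rewrite ler_pdivlMr// mulrC -normE_inner.
  exact: le_trans (cw _) (zB n).
by exists l => y; rewrite wS; under eq_fun do rewrite wS; exact: lP.
Qed.

Definition prod_form (H1 H2 : lmodType R) (w1 : H1 -> H1 -> R)
  (w2 : H2 -> H2 -> R) (z z' : H1 * H2) : R := w1 z.1 z'.1 + w2 z.2 z'.2.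

Section prod_form.
Context {H1 H2 : lmodType R} {w1 : H1 -> H1 -> R} {w2 : H2 -> H2 -> R}
  (hw1 : psd_form w1) (hw2 : psd_form w2).

Lemma prod_form_psd : psd_form (prod_form w1 w2).
Proof.
split=> [x y|a x y z|x]; rewrite /prod_form.
- by rewrite (formC hw1) (formC hw2).
- by rewrite (formDl hw1) (formDl hw2) (formZl hw1) (formZl hw2); ring.
- by rewrite addr_ge0// ?(form_ge0 hw1) ?(form_ge0 hw2).
Qed.

Lemma prod_form_weakly_complete : weakly_complete w1 -> weakly_complete w2 ->
  weakly_complete (prod_form w1 w2).
Proof.
move=> c1 c2 z B G GU zB.
have [|l1 l1P] := c1 (fun n => (z n).1) B G GU.
  by move=> n; have := zB n; have := form_ge0 hw2 (z n).2; rewrite /prod_form; lra.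
have [|l2 l2P] := c2 (fun n => (z n).2) B G GU.
  by move=> n; have := zB n; have := form_ge0 hw1 (z n).1; rewrite /prod_form; lra.
by exists (l1, l2) => y; apply: cvgD; [exact: l1P|exact: l2P].
Qed.

End prod_form.

End weak_compactness.

(** * Relaxed iterations of firmly nonexpansive maps *)

Section limits.
Context {R : realType}.

Lemma cvg0_of_sqr_le (F : set_system nat) (a e : nat -> R) (B : R) :
  Filter F -> (forall n, a n ^+ 2 <= B * e n) -> e n @[n --> F] --> 0 ->
  a n @[n --> F] --> 0.
Proof.
move=> FF aB e0; apply/cvgr0Pnorm_lt => d d0.
have Be : B * e n @[n --> F] --> 0.
  by rewrite -(mulr0 B); apply: cvgM => //; exact: cvg_cst.
have d20 : 0 < d ^+ 2 by rewrite exprn_gt0.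
near=> n; rewrite -(@ltr_pXn2r _ 2)// ?nnegrE ?(ltW d0)//.
rewrite real_normK ?num_real//; apply: le_lt_trans (aB n) _.
by near: n; move/cvgr_lt: Be; apply.
Unshelve. all: by end_near. Qed.

(** If convergence failed along some e > 0, the bad indices would carry an
    ultrafilter finer than the filter of cofinite sets. *)
Lemma ultra_cvg (a : nat -> R) (l : R) :
  (forall G, UltraFilter G -> \oo `<=` G -> a n @[n --> G] --> l) ->
  a n @[n --> \oo] --> l.
Proof.
move=> aG; apply/cvgrPdist_lt => e e0; apply: contrapT => nearN.
pose A := [set n | ~ `|l - a n| < e].
have WF : ProperFilter (within A \oo).
  split; last exact: within_filter.
  move=> W0; apply: nearN.
  have {}W0 : \forall n \near \oo, A n -> False by exact: W0.
  by apply: filterS W0 => n /= An; apply: contrapT => /An.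
have [G [GU WG]] := ultraFilterLemma WF.
have ooG : \oo `<=` G by apply: subset_trans WG; exact: cvg_within.
have GA : G A by apply: WG; exact: withinT.
have /cvgrPdist_lt/(_ e e0) Ge := aG G GU ooG.
by have [n [An /= ne]] := filter_ex (filterI GA Ge); exact: An.
Qed.

Lemma divergent_partial_sums (a : nat -> R) (A : R) : (forall i, 0 <= a i) ->
  (\sum_(0 <= i <oo) (a i)%:E = +oo)%E -> exists N, A < \sum_(0 <= i < N) a i.
Proof.
move=> a0 aoo; apply: contrapT => noN.
have : (\sum_(0 <= i <oo) (a i)%:E <= A%:E)%E.
  apply: lime_le; first by apply: is_cvg_nneseries => n _ _; rewrite lee_fin.
  apply: nearW => n; rewrite sumEFin lee_fin leNgt; apply/negP => An.
  by apply: noN; exists n.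
by rewrite aoo leye_eq.
Qed.

End limits.

Definition firmly_nonexpansive (R : realType) (H : lmodType R)
    (w : H -> H -> R) (T : H -> H) : Prop :=
  forall a b, 0 <= w (T a - T b) ((a - b) - (T a - T b)).

Section krasnoselskii_mann.
Context {R : realType} {H : lmodType R} {w : H -> H -> R} (hw : psd_form w).

Lemma form_cvg0 {F : set_system nat} {FF : Filter F} (r b : nat -> H) (B : R) :
  w (r n) (r n) @[n --> F] --> 0 -> (forall n, w (b n) (b n) <= B) ->
  w (b n) (r n) @[n --> F] --> 0.
Proof.
move=> r0 bB; apply: (cvg0_of_sqr_le (B := B)) r0 => n.
apply: le_trans (form_cauchy_schwarz hw _ _) _.
by rewrite ler_wpM2r// (form_ge0 hw).
Qed.

Context (w_definite : forall x, w x x = 0 -> x = 0).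
Context (w_complete : weakly_complete w).
Context {T : H -> H} (T_firm : firmly_nonexpansive w T).
Context {p : H} (Tp : T p = p).
Context {rho : nat -> R} (rho_02 : forall i, 0 <= rho i <= 2).
Context {z : nat -> H} (zS : forall i, z i.+1 = z i + rho i *: (T (z i) - z i)).

Let r n := T (z n) - z n.

Lemma fejer q n : T q = q ->
  w (z n.+1 - q) (z n.+1 - q) + rho n * (2 - rho n) * w (r n) (r n)
  <= w (z n - q) (z n - q).
Proof.
move=> Tq; have := T_firm (z n) q; rewrite Tq.
have -> : T (z n) - q = (z n - q) + r n.
  by rewrite /r [RHS]addrC addrA subrK.
have -> : z n.+1 - q = (z n - q) + rho n *: r n by rewrite zS addrAC.
have [rho0 _] := andP (rho_02 n).
rewrite opprD addNKr; move: (z n - q) (r n) => d e.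
rewrite !(formE hw) (formC hw e d) => h.
have := mulr_ge0 rho0 h; lra.
Qed.

(** For rho n <= 2 the relaxed step is an average of the identity and of the
    nonexpansive reflection 2 T - 1, so it cannot increase the residual. *)
Lemma residual_decreasing n : w (r n.+1) (r n.+1) <= w (r n) (r n).
Proof.
have [rho0 rho2] := andP (rho_02 n).
have [rn0|rn0] := eqVneq (rho n) 0.
  by rewrite /r zS rn0 scale0r addr0.
have rp : 0 < rho n by rewrite lt_neqAle eq_sym rn0.
have := T_firm (z n.+1) (z n).
pose e := r n.+1 - r n.
have zd : z n.+1 - z n = rho n *: r n by rewrite zS addrC addKr.
have -> : T (z n.+1) - T (z n) = rho n *: r n + e.
  have Tz m : T (z m) = z m + r m by rewrite /r addrC subrK.
  by rewrite -zd /e !Tz opprD addrACA.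
rewrite zd opprD addNKr.
have -> : r n.+1 = r n + e by rewrite /e addrC subrK.
rewrite form_sqrD//; clearbody e; move: (r n) => a.
rewrite !(formE hw) => h.
have wee := form_ge0 hw e.
have : rho n * (2 * w a e + w e e) <= 0.
  by have := mulr_ge0 (_ : 0 <= 2 - rho n) wee; rewrite subr_ge0 => /(_ rho2); lra.
by rewrite pmulr_rle0//; lra.
Qed.

Lemma residual_nonincreasing m n : (m <= n)%N -> w (r n) (r n) <= w (r m) (r m).
Proof.
move=> /subnK <-; elim: (n - m)%N => [//|k IH].
exact: le_trans (residual_decreasing _) IH.
Qed.

Context (rho_sum : (\sum_(0 <= i <oo) (rho i * (2 - rho i))%:E)%E = +oo%E).

(** Summing the Fejer inequalities bounds the weighted residuals; since the
    residuals decrease and the weights diverge, they must vanish. *)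
Lemma residual_cvg0 : w (r n) (r n) @[n --> \oo] --> 0.
Proof.
have lam0 i : 0 <= rho i * (2 - rho i).
  by have [rho0 rho2] := andP (rho_02 i); rewrite mulr_ge0 ?subr_ge0.
pose C := w (z 0 - p) (z 0 - p).
have sumC n : (\sum_(0 <= i < n) rho i * (2 - rho i)) * w (r n) (r n) +
    w (z n - p) (z n - p) <= C.
  elim: n => [|n IH]; first by rewrite big_nil mul0r add0r.
  rewrite big_nat_recr//= mulrDl; apply: le_trans IH.
  have := fejer n Tp.
  have S0 : 0 <= \sum_(0 <= i < n) rho i * (2 - rho i) by apply: sumr_ge0.
  have := ler_wpM2l S0 (residual_decreasing n).
  have := ler_wpM2l (lam0 n) (residual_decreasing n).
  lra.
apply/cvgr0Pnorm_lt => e e0.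
have [N CN] := divergent_partial_sums (C / e) lam0 rho_sum.
exists N => // n /= Nn; rewrite ger0_norm ?(form_ge0 hw)//.
apply: le_lt_trans (residual_nonincreasing Nn) _.
have C0 : 0 <= C by exact: form_ge0.
have SN : 0 < \sum_(0 <= i < N) rho i * (2 - rho i).
  by apply: le_lt_trans CN; rewrite divr_ge0// ltW.
rewrite -(ltr_pM2l SN); apply: (@le_lt_trans _ _ C).
  by have := sumC N; have := form_ge0 hw (z N - p); lra.
by rewrite -ltr_pdivrMr.
Qed.

Lemma distance_nonincreasing q : T q = q ->
  nonincreasing_seq (fun n => w (z n - q) (z n - q)).
Proof.
move=> Tq; apply/nonincreasing_seqP => n; have := fejer n Tq.
have [rho0 rho2] := andP (rho_02 n).
have : 0 <= rho n * (2 - rho n) * w (r n) (r n).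
  by rewrite mulr_ge0 ?(form_ge0 hw)// mulr_ge0 ?subr_ge0.
by lra.
Qed.

Lemma distance_cvg q : T q = q -> cvg (w (z n - q) (z n - q) @[n --> \oo]).
Proof.
move=> Tq; apply: nonincreasing_is_cvgn; first exact: distance_nonincreasing.
by exists 0 => _ [n _ <-]; exact: form_ge0.
Qed.

Lemma iterates_bounded n : w (z n) (z n) <= 2 * (w (z 0%N - p) (z 0%N - p) + w p p).
Proof.
have := distance_nonincreasing Tp (leq0n n).
have := form_ge0 hw (z n - 2 *: p).
rewrite (formBl hw (z n) p) !(formE hw) (formC hw p (z n)); lra.
Qed.

(** Demiclosedness of the identity minus T at 0: passing to the limit in firm
    nonexpansiveness between z n and l leaves - w (l - T l) (l - T l) >= 0. *)
Lemma weak_cluster_fixed G l : UltraFilter G -> \oo `<=` G ->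
  (forall y, w (z n) y @[n --> G] --> w l y) -> T l = l.
Proof.
move=> GU ooG zl.
have rG : w (r n) (r n) @[n --> G] --> 0.
  by move=> S /residual_cvg0 /ooG.
pose v := l - T l.
(* firm nonexpansiveness between z n and l, solved for the only term that
   does not involve the residual *)
have ineq n : w (z n) v <= w (T l) v - w (z n - T l + v) (r n) - w (r n) (r n).
  have := T_firm (z n) l.
  have -> : T (z n) = z n + r n by rewrite /r addrC subrK.
  have diffE (a b : H) : a - l - (a + b - T l) = - (b + v).
    rewrite -(addrA a b) opprD addrACA subrr add0r opprB addrCA addrA.
    by rewrite [RHS]opprD /v opprB [RHS]addrC.
  rewrite diffE.
  clearbody v; move: (z n) (r n) (T l) => a e c.
  by rewrite !(formE hw) (formC hw v e); lra.
have zv : w l v <= w (T l) v.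
  have rhs : w (T l) v - w (z n - T l + v) (r n) - w (r n) (r n) @[n --> G]
      --> w (T l) v.
    rewrite -[X in _ --> X]subr0 -[X in _ --> X]subr0.
    apply: cvgB => //; apply: cvgB; first exact: cvg_cst.
    apply: (form_cvg0 (B := 2 * (2 * (w (z 0%N - p) (z 0%N - p) + w p p) +
      w (v - T l) (v - T l)))) rG _ => n.
    have := iterates_bounded n; have := form_ge0 hw (z n - (v - T l)).
    have -> : z n - T l + v = z n + (v - T l) by rewrite -addrA (addrC v).
    move: (z n) (v - T l) (w (z 0%N - p) _ + _) => a c K.
    by rewrite !(formE hw) (formC hw c a); lra.
  by apply: (ler_cvg_to (zl v) rhs); apply: filterE => n; exact: ineq.
apply/eqP; rewrite eq_sym -subr_eq0; apply/eqP/w_definite.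
apply/eqP; rewrite eq_le (form_ge0 hw) andbT {1}(formBl hw) subr_le0.
exact: zv.
Qed.

(** Opial's argument: the distances to two weak cluster points converge, hence
    so does w (z n) (l1 - l2), whose limits along the two filters must agree. *)
Lemma weak_cluster_unique G1 G2 l1 l2 : UltraFilter G1 -> UltraFilter G2 ->
  \oo `<=` G1 -> \oo `<=` G2 ->
  (forall y, w (z n) y @[n --> G1] --> w l1 y) ->
  (forall y, w (z n) y @[n --> G2] --> w l2 y) -> l1 = l2.
Proof.
move=> U1 U2 oo1 oo2 z1 z2.
have d1 := distance_cvg (weak_cluster_fixed U1 oo1 z1).
have d2 := distance_cvg (weak_cluster_fixed U2 oo2 z2).
have [c zc] : exists c : R, w (z n) (l1 - l2) @[n --> \oo] --> c.
  exists (2^-1 * (lim (w (z n - l2) (z n - l2) @[n --> \oo]) -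
    lim (w (z n - l1) (z n - l1) @[n --> \oo]) + (w l1 l1 - w l2 l2))).
  have E n : w (z n) (l1 - l2) = 2^-1 * (w (z n - l2) (z n - l2) -
      w (z n - l1) (z n - l1) + (w l1 l1 - w l2 l2)).
    by rewrite !(formE hw) (formC hw l1 (z n)) (formC hw l2 (z n)); field.
  under eq_fun do rewrite E.
  apply: cvgM; first exact: cvg_cst.
  by apply: cvgD; [exact: cvgB|exact: cvg_cst].
have e1 : w l1 (l1 - l2) = c.
  apply: (cvg_unique _ (z1 (l1 - l2))) => //.
  by move=> S /zc /oo1.
have e2 : w l2 (l1 - l2) = c.
  apply: (cvg_unique _ (z2 (l1 - l2))) => //.
  by move=> S /zc /oo2.
apply/eqP; rewrite -subr_eq0; apply/eqP/w_definite.
by rewrite (formBl hw l1) e1 e2 subrr.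
Qed.

(** All ultrafilters finer than the filter of cofinite sets give the same weak
    limit, which is therefore the weak limit of the sequence. *)
Theorem krasnoselskii_mann :
  exists2 l, T l = l & forall y, w (z n) y @[n --> \oo] --> w l y.
Proof.
have [G0 [U0 oo0]] := @ultraFilterLemma nat \oo _.
have [l zl] := w_complete U0 iterates_bounded.
exists l; first exact: weak_cluster_fixed zl.
move=> y; apply: ultra_cvg => G U oo.
have [l' zl'] := w_complete U iterates_bounded.
by rewrite (weak_cluster_unique U0 U oo0 oo zl zl').
Qed.

(** This is the right-hand side of the energy inequality between an iterate and
    a fixed point, so whatever it dominates vanishes along the iterates. *)
Lemma firm_gap_cvg0 q : T q = q ->
  w (T (z n) - T q) ((z n - q) - (T (z n) - T q)) @[n --> \oo] --> 0.
Proof.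
move=> Tq.
have gapE n : w (T (z n) - T q) ((z n - q) - (T (z n) - T q)) =
    - w (T (z n) - T q) (r n).
  have diffE (a b c : H) : a - b - (c - b) = - (c - a).
    by rewrite opprB addrA subrK opprB.
  by rewrite {2}Tq diffE (formNr hw).
under eq_fun do rewrite gapE.
rewrite -oppr0; apply: cvgN.
apply: (form_cvg0 (B := w (z 0%N - q) (z 0%N - q))) residual_cvg0 _ => n.
have := distance_nonincreasing Tq (leq0n n).
have := T_firm (z n) q; have := form_ge0 hw ((z n - q) - (T (z n) - T q)).
move: (z n - q) (T (z n) - T q) => a b.
by rewrite !(formE hw) (formC hw b a); lra.
Qed.

End krasnoselskii_mann.

(** * The two primal-dual operators *)

Lemma subBB (V : zmodType) (a b c d : V) : (a - b) - (c - d) = (a - c) - (b - d).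
Proof. by rewrite !opprD !opprK addrACA. Qed.

Section primal_dual.
Context {R : realType} {X U : hilbertType R}.
Context {M : {linear X -> X}} {K : {linear U -> X}} {Lam : {linear X -> U}}.
Context {q k kappa : R}.
Context (M_adj : is_adjoint M M) (M_ge0 : forall x, 0 <= inner x (M x)).
Context (q_01 : 0 <= q < 1) (M_le : forall x, `|M x| <= q * `|x|).
Context (kappa_gt0 : 0 < kappa).
Context (Lam_adj : forall x u, kappa * inner (Lam x) u = inner x (K u)).
Context (k_ge0 : 0 <= k) (K_le : forall u, `|K u| <= k * `|u|).
Context (k_kappa : k ^+ 2 < kappa).

Let M_sym x y : inner x (M y) = inner y (M x).
Proof. by rewrite innerC M_adj. Qed.

(** With M = (tau/2) Q and K = tau L^* these are, up to the factor tau, the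
    metrics of I/tau - Q/2 and I/sigma - tau L L^*. *)
Definition primal_metric (a b : X) : R := inner a (b - M b).

Definition dual_metric (a b : U) : R := kappa * inner a b - inner (K a) (K b).

Lemma primal_metric_coercive x : (1 - q) * `|x| ^+ 2 <= primal_metric x x.
Proof.
rewrite /primal_metric (formBr inner_form) -normE_inner.
have := ler_norm (inner x (M x)); have := inner_le x (M x).
have := ler_wpM2l (normr_ge0 x) (M_le x).
by rewrite mulrCA -expr2; lra.
Qed.

Lemma dual_metric_coercive u : (kappa - k ^+ 2) * `|u| ^+ 2 <= dual_metric u u.
Proof.
rewrite /dual_metric -!normE_inner.
have : `|K u| ^+ 2 <= (k * `|u|) ^+ 2.
  by rewrite ler_pXn2r ?nnegrE ?mulr_ge0.
by rewrite exprMn; lra.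
Qed.

Lemma primal_metric_psd : psd_form primal_metric.
Proof.
split=> [x y|a x y z|x].
- by rewrite /primal_metric !innerE (innerC y x) (M_sym y x).
- by rewrite /primal_metric !innerE; ring.
- apply: le_trans (primal_metric_coercive x).
  by rewrite mulr_ge0 ?sqr_ge0// subr_ge0 ltW//; case/andP: q_01.
Qed.

Lemma dual_metric_psd : psd_form dual_metric.
Proof.
split=> [x y|a x y z|x].
- by rewrite /dual_metric (innerC y x) (innerC (K y)).
- by rewrite /dual_metric linearP !innerE; ring.
- apply: le_trans (dual_metric_coercive x).
  by rewrite mulr_ge0 ?sqr_ge0// subr_ge0 ltW.
Qed.

Lemma primal_metric_weakly_complete : weakly_complete primal_metric.
Proof.
apply: (@coercive_weakly_complete _ _ _ (fun x => x - M x) (1 - q)) => //.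
  by rewrite subr_gt0; case/andP: q_01.
exact: primal_metric_coercive.
Qed.

Lemma dual_metricE a b : dual_metric a b = inner a (kappa *: (b - Lam (K b))).
Proof.
rewrite /dual_metric (formZr inner_form) (formBr inner_form) mulrBr.
by rewrite (innerC a (Lam _)) Lam_adj (innerC (K a)).
Qed.

Lemma dual_metric_weakly_complete : weakly_complete dual_metric.
Proof.
apply: (coercive_weakly_complete (c := kappa - k ^+ 2) dual_metricE).
  by rewrite subr_gt0.
exact: dual_metric_coercive.
Qed.

Lemma primal_metric_surjective v :
  exists a, forall b, primal_metric b a = inner b v.
Proof.
have [a aE] := id_sub_surjective v q_01 M_le.
by exists a => b; rewrite /primal_metric aE.
Qed.

Lemma Lam_le x : `|Lam x| <= k / kappa * `|x|.
Proof.
have adj : is_adjoint K (fun x => kappa *: Lam x).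
  by move=> u y; rewrite (formZr inner_form) (innerC u) Lam_adj innerC.
have := adjoint_le x adj k_ge0 K_le.
rewrite normrZ gtr0_norm// => h.
by rewrite mulrAC ler_pdivlMr// mulrC.
Qed.

(** Surjectivity of the operators of both metrics transfers weak convergence for
    the metric to weak convergence for the inner products
    ([metric_cvg_weak]). *)
Lemma dual_metric_surjective v :
  exists a, forall b, dual_metric b a = inner b v.
Proof.
have q'01 : 0 <= k ^+ 2 / kappa < 1.
  by rewrite divr_ge0 ?sqr_ge0 ?(ltW kappa_gt0)//= ltr_pdivrMr// mul1r.
have N_le u : `|(Lam \o K) u| <= k ^+ 2 / kappa * `|u|.
  rewrite /=; apply: le_trans (Lam_le _) _.
  have kk0 : 0 <= k / kappa by rewrite divr_ge0// ltW.
  have := ler_wpM2l kk0 (K_le u).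
  by rewrite mulrA expr2 (mulrAC k k).
have [a aE] := id_sub_surjective (kappa^-1 *: v) q'01 N_le.
exists a => b; rewrite dual_metricE -[Lam (K a)]/((Lam \o K) a) aE.
by rewrite scalerA divff ?scale1r// gt_eqF.
Qed.

Definition metric : X * U -> X * U -> R := prod_form primal_metric dual_metric.

Lemma metric_psd : psd_form metric.
Proof. exact: prod_form_psd primal_metric_psd dual_metric_psd. Qed.

Lemma metric_weakly_complete : weakly_complete metric.
Proof.
apply: prod_form_weakly_complete.
- exact: primal_metric_psd.
- exact: dual_metric_psd.
- exact: primal_metric_weakly_complete.
- exact: dual_metric_weakly_complete.
Qed.

Lemma metric_definite z : metric z z = 0 -> z = 0.
Proof.
move=> z0; have h1 := form_ge0 primal_metric_psd z.1.
have h2 := form_ge0 dual_metric_psd z.2.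
have e1 : primal_metric z.1 z.1 = 0.
  by apply/eqP; rewrite eq_le h1 andbT; move: z0; rewrite /metric /prod_form; lra.
have e2 : dual_metric z.2 z.2 = 0.
  by apply/eqP; rewrite eq_le h2 andbT; move: z0; rewrite /metric /prod_form; lra.
have zero (V : hilbertType R) (c : R) (v : V) : 0 < c -> c * `|v| ^+ 2 <= 0 -> v = 0.
  move=> c0; rewrite pmulr_rle0// => v0; apply/eqP.
  by rewrite -normr_eq0 -sqrf_eq0 eq_le v0 sqr_ge0.
have z1 : z.1 = 0.
  apply: (@zero _ (1 - q)); first by rewrite subr_gt0; case/andP: q_01.
  by rewrite -e1 primal_metric_coercive.
have z2 : z.2 = 0.
  apply: (@zero _ (kappa - k ^+ 2)); first by rewrite subr_gt0.
  by rewrite -e2 dual_metric_coercive.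
by rewrite [z]surjective_pairing z1 z2.
Qed.

Lemma metric_cvg_weak (z : nat -> X * U) (l : X * U) :
  (forall y, metric (z n) y @[n --> \oo] --> metric l y) ->
  weak_cvg (fun n => (z n).1) l.1 /\ weak_cvg (fun n => (z n).2) l.2.
Proof.
move=> zl; split=> v.
  have [a aP] := primal_metric_surjective v.
  have E (y : X * U) : metric y (a, 0) = inner y.1 v.
    by rewrite /metric /prod_form /= aP (form0r dual_metric_psd) addr0.
  by rewrite -E; under eq_fun do rewrite -E; exact: zl.
have [a aP] := dual_metric_surjective v.
have E (y : X * U) : metric y (0, a) = inner y.2 v.
  by rewrite /metric /prod_form /= aP (form0r primal_metric_psd) add0r.
by rewrite -E; under eq_fun do rewrite -E; exact: zl.
Qed.

Context {Pf : X -> X} {Pg : U -> U}.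
Context (Pf_firm : firmly_nonexpansive (@inner R X) Pf).
Context (Pg_firm : firmly_nonexpansive (@inner R U) Pg).

(** When Pf is the proximity operator of tau f composed with the translation by
    - tau c, and Pg that of sigma g^*, this is the optimality system
    - L^* u - Q x - c \in \partial f (x) and L x \in \partial g^* (u). *)
Definition saddle (x : X) (u : U) : Prop :=
  Pf (x - K u - 2 *: M x) = x /\ Pg (u + Lam x) = u.

(** The half-step point x and the map T of form I, where x is computed before
    the dual variable. *)
Definition primal_first (s : X) : X := Pf (s - M s).

Definition step_primal_first (z : X * U) : X * U :=
  let x := primal_first z.1 in
  let u' := Pg (z.2 + Lam (2 *: x - z.1 - M (2 *: x - z.1) - K z.2)) in
  (x - M (2 *: x - z.1) - K u', u').

(** The dual half-step point and the map T of form II, where the dual variable is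
    computed before x. *)
Definition dual_first (z : X * U) : U := Pg (z.2 + Lam (z.1 - M z.1 - K z.2)).

Definition step_dual_first (z : X * U) : X * U :=
  let u' := dual_first z in
  let y := z.1 - M z.1 - K u' in
  let x := Pf (2 *: y - z.1 - M (2 *: y - z.1)) in
  (z.1 + (x - y), u').


(** Monotonicity of the dual step. Writing its input A as dy + K (du' - du)
    lets K (du' - du) complete the dual metric; the cross term <dy, K du'> left
    over is the one that the primal step compensates. *)
Lemma dual_resolvent_ineq (A dy : X) (du du' : U) :
  A = dy + K du' - K du -> 0 <= inner du' (du + Lam A - du') ->
  0 <= dual_metric du' (du - du') + inner dy (K du').
Proof.
move=> AE h; have := mulr_ge0 (ltW kappa_gt0) h.
rewrite !innerE (innerC du' (Lam A)) !mulrDr Lam_adj AE.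
by rewrite /dual_metric linearB !innerE (innerC (K du')); lra.
Qed.

(** Once K du' is eliminated in favour of the second half-step point dy, the
    difference of the two sides is the sum of <dy, M dy>, of the first
    hypothesis and of kappa times the second one. *)
Lemma energy_primal_first (ds dx : X) (du du' : U) :
  let ds' := dx - M (2 *: dx - ds) - K du' in
  0 <= inner dx (ds - M ds - dx) ->
  0 <= inner du' (du + Lam (2 *: dx - ds - M (2 *: dx - ds) - K du) - du') ->
  inner dx (M dx) <=
    primal_metric ds' (ds - ds') + dual_metric du' (du - du').
Proof.
move=> ds' hx hu; pose dy := ds' - ds + dx.
have KE : K du' = 2 *: dx - ds - M (2 *: dx - ds) - dy.
  by apply: inner_inj => t; rewrite /dy /ds' !innerE; ring.
have AE : 2 *: dx - ds - M (2 *: dx - ds) - K du = dy + K du' - K du.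
  by rewrite KE; apply: inner_inj => t; rewrite !innerE; ring.
have := dual_resolvent_ineq AE hu.
have -> : ds' = dy + ds - dx.
  by rewrite /dy; apply: inner_inj => t; rewrite !innerE; ring.
have := M_ge0 dy; move: hx; rewrite KE; move: dy {AE KE} => dy.
rewrite /primal_metric !(linearB M, linearD M, linearN M, linearZ) /= !innerE.
rewrite ?(M_sym dy dx) ?(M_sym ds dx) ?(M_sym ds dy).
rewrite ?(innerC dy dx) ?(innerC ds dx) ?(innerC ds dy).
lra.
Qed.

(** Same elimination of K du' as in form I, with the roles of the two half-step
    points exchanged. *)
Lemma energy_dual_first (ds dx : X) (du du' : U) :
  let dy := ds - M ds - K du' in
  let ds' := ds + (dx - dy) in
  0 <= inner du' (du + Lam (ds - M ds - K du) - du') ->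
  0 <= inner dx (2 *: dy - ds - M (2 *: dy - ds) - dx) ->
  0 <= primal_metric ds' (ds - ds') + dual_metric du' (du - du').
Proof.
move=> dy ds' hu hx.
have KE : K du' = ds - M ds - dy.
  by apply: inner_inj => t; rewrite /dy !innerE; ring.
have AE : ds - M ds - K du = dy + K du' - K du.
  by rewrite KE; apply: inner_inj => t; rewrite !innerE; ring.
have := dual_resolvent_ineq AE hu.
rewrite {}/ds' in hx *; have := M_ge0 dy; have := M_ge0 dx.
move: hx; rewrite KE; move: dy {AE KE} => dy.
rewrite /primal_metric !(linearB M, linearD M, linearN M, linearZ) /= !innerE.
rewrite ?(M_sym dy dx) ?(M_sym ds dx) ?(M_sym ds dy).
rewrite ?(innerC dy dx) ?(innerC ds dx) ?(innerC ds dy).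
lra.
Qed.

Lemma step_primal_first_energy z1 z2 :
  inner (primal_first z1.1 - primal_first z2.1)
        (M (primal_first z1.1 - primal_first z2.1)) <=
  metric (step_primal_first z1 - step_primal_first z2)
         ((z1 - z2) - (step_primal_first z1 - step_primal_first z2)).
Proof.
case: z1 z2 => [s1 u1] [s2 u2].
set dz' := step_primal_first _ - _; set dx := primal_first _ - _.
rewrite /= in dx *.
pose A s u := 2 *: primal_first s - s - M (2 *: primal_first s - s) - K u.
have AE : A s1 u1 - A s2 u2 = 2 *: dx - (s1 - s2) - M (2 *: dx - (s1 - s2))
    - K (u1 - u2).
  apply: inner_inj => t; rewrite /A /dx !(linearB M, linearB K, linearZ) /=.
  by rewrite !innerE; ring.
pose du' := dz'.2.
have hu := Pg_firm (u1 + Lam (A s1 u1)) (u2 + Lam (A s2 u2)).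
have hx := Pf_firm (s1 - M s1) (s2 - M s2).
have := @energy_primal_first (s1 - s2) dx (u1 - u2) du' _ _.
have -> : dx - M (2 *: dx - (s1 - s2)) - K du' = dz'.1.
  rewrite /du' /dz' /= -/(A s1 u1) -/(A s2 u2) !linearB /=.
  apply: inner_inj => t; rewrite /dx !(linearB M, linearB K, linearZ) /=.
  by rewrite !innerE; ring.
apply.
  rewrite (_ : _ - M _ = (s1 - M s1) - (s2 - M s2)); first exact: hx.
  by rewrite linearB subBB.
rewrite -AE linearB addrACA -opprD; exact: hu.
Qed.

Lemma step_primal_first_firm : firmly_nonexpansive metric step_primal_first.
Proof.
by move=> z1 z2; apply: le_trans (M_ge0 _) (step_primal_first_energy z1 z2).
Qed.

Lemma step_dual_first_firm : firmly_nonexpansive metric step_dual_first.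
Proof.
case=> [s1 u1] [s2 u2].
pose y s u := s - M s - K (dual_first (s, u)).
pose A s u := s - M s - K u.
pose du' := dual_first (s1, u1) - dual_first (s2, u2).
have hu := Pg_firm (u1 + Lam (A s1 u1)) (u2 + Lam (A s2 u2)).
pose B s u := 2 *: y s u - s - M (2 *: y s u - s).
have hx := Pf_firm (B s1 u1) (B s2 u2).
pose dx := Pf (B s1 u1) - Pf (B s2 u2).
have yE : s1 - s2 - M (s1 - s2) - K du' = y s1 u1 - y s2 u2.
  apply: inner_inj => t; rewrite /y /du' !(linearB M, linearB K, linearZ) /=.
  by rewrite !innerE; ring.
have := @energy_dual_first (s1 - s2) dx (u1 - u2) du' _ _.
rewrite yE.
have -> : s1 - s2 + (dx - (y s1 u1 - y s2 u2)) =
    (step_dual_first (s1, u1)).1 - (step_dual_first (s2, u2)).1.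
  by rewrite subBB addrACA -opprD.
apply.
  rewrite (_ : _ - M _ - _ = A s1 u1 - A s2 u2).
    by rewrite linearB addrACA -opprD; exact: hu.
  apply: inner_inj => t; rewrite /A !(linearB M, linearB K, linearZ) /=.
  by rewrite !innerE; ring.
rewrite (_ : 2 *: _ - _ - _ = B s1 u1 - B s2 u2); first exact: hx.
apply: inner_inj => t; rewrite /B !(linearB M, linearB K, linearZ) /=.
by rewrite !innerE; ring.
Qed.


Lemma primal_first_fixed z : step_primal_first z = z ->
  saddle (primal_first z.1) z.2.
Proof.
case: z => s u; rewrite /step_primal_first /=.
have : primal_first s = Pf (s - M s) by [].
move: (primal_first s) => x xE; case; set u' := Pg _ => sE u'E.
rewrite u'E in sE.
have KE : K u = x - M (2 *: x - s) - s.
  by apply: inner_inj => t; move: (congr1 (inner^~ t) sE); rewrite !innerE; lra.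
split.
  rewrite {3}xE; congr Pf; rewrite KE; apply: inner_inj => t.
  by rewrite !(linearB M, linearZ) /= !innerE; ring.
rewrite -[in RHS]u'E /u'; congr (Pg (_ + Lam _)); rewrite KE.
by apply: inner_inj => t; rewrite !innerE; ring.
Qed.

Lemma primal_first_fixed_exists x u : saddle x u ->
  exists s, step_primal_first (s, u) = (s, u).
Proof.
case=> xE uE; have [s sE] := id_sub_surjective (x - K u - 2 *: M x) q_01 M_le.
exists s; rewrite /step_primal_first /primal_first /= sE xE.
have AE : 2 *: x - s - M (2 *: x - s) - K u = x.
  apply: inner_inj => t; move: (congr1 (inner^~ t) sE).
  by rewrite !(linearB M, linearZ) /= !innerE; lra.
rewrite AE uE; congr (_, _); apply: inner_inj => t.
by move: (congr1 (inner^~ t) AE); rewrite !innerE; lra.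
Qed.

Lemma dual_first_fixed z : step_dual_first z = z ->
  saddle (z.1 - M z.1 - K z.2) z.2.
Proof.
case: z => s u; rewrite /step_dual_first /=.
have : dual_first (s, u) = Pg (u + Lam (s - M s - K u)) by [].
move: (dual_first _) => u' u'E [] /[swap] uE.
rewrite uE in u'E *; set y := s - M s - K u; set x := Pf _ => sE.
have xy : x = y.
  by apply: inner_inj => t; move: (congr1 (inner^~ t) sE); rewrite !innerE; lra.
split; last by rewrite -u'E.
rewrite -[RHS]xy /x; congr Pf; rewrite /y.
apply: inner_inj => t.
by rewrite !(linearB M, linearZ) /= !innerE; ring.
Qed.

Lemma dual_first_fixed_exists x u : saddle x u ->
  exists s, step_dual_first (s, u) = (s, u).
Proof.
case=> xE uE; have [s sE] := id_sub_surjective (x + K u) q_01 M_le.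
exists s; rewrite /step_dual_first /dual_first /= sE addrK uE addrK.
rewrite (_ : 2 *: x - s - M _ = x - K u - 2 *: M x).
  by rewrite xE subrr addr0.
apply: inner_inj => t; move: (congr1 (inner^~ t) sE).
by rewrite !(linearB M, linearZ) /= !innerE; lra.
Qed.

Context {rho : nat -> R} (rho_02 : forall i, 0 <= rho i <= 2).
Context (rho_sum : (\sum_(0 <= i <oo) (rho i * (2 - rho i))%:E)%E = +oo%E).
Context {x0 : X} {u0 : U} (saddle0 : saddle x0 u0).
Context {z : nat -> X * U}.

(** The Krasnoselskii-Mann theorem in terms of the inner products of X and U.
    The image T (z n) converges weakly to the same limit because the residual
    vanishes. *)
Lemma relaxed_iterates_cvg (T : X * U -> X * U) p :
  firmly_nonexpansive metric T -> T p = p ->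
  (forall i, z i.+1 = z i + rho i *: (T (z i) - z i)) ->
  exists2 l, T l = l &
    [/\ weak_cvg (fun n => (z n).1) l.1, weak_cvg (fun n => (z n).2) l.2,
        weak_cvg (fun n => (T (z n)).1) l.1,
        weak_cvg (fun n => (T (z n)).2) l.2 &
        metric (T (z n) - T l) ((z n - l) - (T (z n) - T l)) @[n --> \oo] --> 0].
Proof.
move=> T_firm Tp zS.
have [l Tl zl] := krasnoselskii_mann metric_psd metric_definite
  metric_weakly_complete T_firm Tp rho_02 zS rho_sum.
exists l => //.
have r0 := residual_cvg0 metric_psd T_firm Tp rho_02 zS rho_sum.
have Tzl y : metric (T (z n)) y @[n --> \oo] --> metric l y.
  have ry : metric y (T (z n) - z n) @[n --> \oo] --> 0.
    exact: (form_cvg0 metric_psd (b := fun=> y) r0 (fun n => lexx _)).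
  have E n : metric (T (z n)) y = metric (z n) y + metric y (T (z n) - z n).
    by rewrite (formBr metric_psd) !(formC metric_psd y); ring.
  under eq_fun do rewrite E.
  by rewrite -[metric l y]addr0; exact: cvgD (zl y) ry.
have [cv1 cv2] := metric_cvg_weak zl.
have [cv1' cv2'] := metric_cvg_weak (z := fun n => T (z n)) Tzl.
split; [exact: cv1|exact: cv2|exact: cv1'|exact: cv2'|].
exact (firm_gap_cvg0 metric_psd T_firm Tp rho_02 zS rho_sum Tl).
Qed.

(** The energy inequality between z n and the limit point gives
    <dx, M dx> -> 0, hence M dx -> 0 weakly. The update formula of s determines
    <x, v> from M x and from weakly convergent quantities only. *)
Theorem primal_first_cvg :
  (forall i, z i.+1 = z i + rho i *: (step_primal_first (z i) - z i)) ->
  exists x u, [/\ saddle x u,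
    weak_cvg (fun n => primal_first (z n).1) x & weak_cvg (fun n => (z n).2) u].
Proof.
move=> zS; have [s0 fix0] := primal_first_fixed_exists saddle0.
have [l Tl [cv1 cv2 cv1' cv2' gap]] :=
  relaxed_iterates_cvg step_primal_first_firm fix0 zS.
exists (primal_first l.1), l.2; split=> //; first exact: primal_first_fixed.
set x := primal_first l.1.
pose w (a b : X) := inner a (M b).
have w_psd : psd_form w.
  split=> [a b|a b c d|a]; rewrite /w.
  - exact: M_sym.
  - by rewrite !innerE.
  - exact: M_ge0.
have w0 : w (primal_first (z n).1 - x) (primal_first (z n).1 - x)
    @[n --> \oo] --> 0.
  apply: (squeeze_cvgr _ (cvg_cst 0) gap); apply: filterE => n.
  by rewrite M_ge0 /=; exact: step_primal_first_energy.
move=> v.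
have Mx : w v (primal_first (z n).1 - x) @[n --> \oo] --> 0.
  exact: (form_cvg0 w_psd (b := fun=> v) w0 (fun n => lexx _)).
(* the update of s, solved for x and tested against v *)
have stepE y : inner (primal_first y.1) v = inner (step_primal_first y).1 v
    + 2 * w v (primal_first y.1) - inner y.1 (M v)
    + kappa * inner (step_primal_first y).2 (Lam v).
  rewrite /step_primal_first /=; set u' := Pg _.
  rewrite (innerC u') Lam_adj /w !(linearB M, linearZ) /= !innerE.
  by rewrite (M_adj y.1) !(innerC v); ring.
rewrite stepE Tl; under eq_fun do rewrite stepE.
have Mxv : w v (primal_first (z n).1) @[n --> \oo] --> w v x.
  rewrite -[w v x]add0r.
  have E n : w v (primal_first (z n).1) =
      w v (primal_first (z n).1 - x) + w v x.
    by rewrite (formBr w_psd) subrK.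
  by under eq_fun do rewrite E; apply: cvgD => //; exact: cvg_cst.
apply: cvgD; last by apply: cvgM; [exact: cvg_cst|exact: cv2'].
apply: cvgB; last exact: cv1.
by apply: cvgD; [exact: cv1'|apply: cvgM => //; exact: cvg_cst].
Qed.

(** Here x is read off from T (z n), s and the new dual variable, which all
    converge weakly, by a continuous affine formula. *)
Theorem dual_first_cvg {xh : nat -> X} :
  (forall i, z i.+1 = z i + rho i *: (step_dual_first (z i) - z i)) ->
  (forall i, (step_dual_first (z i)).1 =
     (z i).1 + (xh i - ((z i).1 - M (z i).1 - K (dual_first (z i))))) ->
  exists x u, [/\ saddle x u, weak_cvg xh x & weak_cvg (fun n => (z n).2) u].
Proof.
move=> zS xhE; have [s0 fix0] := dual_first_fixed_exists saddle0.
have [l Tl [cv1 cv2 cv1' cv2' _]] :=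
  relaxed_iterates_cvg step_dual_first_firm fix0 zS.
exists (l.1 - M l.1 - K l.2), l.2; split=> //; first exact: dual_first_fixed.
move=> v.
have E n : inner (xh n) v = inner (step_dual_first (z n)).1 v
    - inner (z n).1 (M v) - kappa * inner (step_dual_first (z n)).2 (Lam v).
  rewrite xhE /= (innerC (dual_first _)) Lam_adj !innerE (M_adj (z n).1).
  by rewrite (innerC v); ring.
have -> : inner (l.1 - M l.1 - K l.2) v =
    inner l.1 v - inner l.1 (M v) - kappa * inner l.2 (Lam v).
  by rewrite (innerC l.2) Lam_adj !innerE (M_adj l.1) (innerC v).
under eq_fun do rewrite E.
apply: cvgB; last by apply: cvgM; [exact: cvg_cst|exact: cv2'].
by apply: cvgB; [exact: cv1'|exact: cv1].
Qed.

End primal_dual.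

(** * Optimality conditions *)

Section optimality.
Context {R : realType} {X U : hilbertType R}.
Context {f : X -> \bar R} {g : U -> \bar R}.
Context {L : {linear X -> U}} {Ladj : U -> X} {Q : {linear X -> X}} {c : X}.
Context (f_proper : Defs.proper f) (g_proper : Defs.proper g).
Context (L_adj : is_adjoint L Ladj) (Q_adj : is_adjoint Q Q).
Context (Q_ge0 : forall x, 0 <= inner x (Q x)).

Lemma quadraticD x d : quadratic Q c (x + d) =
  quadratic Q c x + inner d (Q x + c) + 2^-1 * inner d (Q d).
Proof.
rewrite /quadratic linearD !innerE -(Q_adj x d) (innerC (Q x) d).
by field.
Qed.

(** Gradients are unique, so it suffices to compute directional derivatives,
    which the exact second-order expansion gives. *)
Lemma gradient_quadratic x v : is_gradient (quadratic Q c) x v -> v = Q x + c.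
Proof.
move=> [diffh dE]; apply: inner_inj => d.
have := deriveE d diffh; rewrite dE => <-.
rewrite /derive; apply: cvg_lim => //.
have cvg_id0 : (t : R) @[t --> 0^'] --> (0 : R).
  by apply: cvg_within_filter; exact: cvg_id.
have E : {near 0^', (fun t : R => inner (Q x + c) d + t * (2^-1 * inner d (Q d)))
   =1 (fun t => t^-1 *: ((quadratic Q c \o shift x) (t *: d) - quadratic Q c x))}.
  near=> t; have t0 : t != 0 by near: t; exact: nbhs_dnbhs_neq.
  rewrite /= (addrC _ x) quadraticD linearZ /= !innerE (innerC (Q x)) (innerC c).
  by rewrite /GRing.scale /=; field.
apply: cvg_trans (near_eq_cvg E) _.
have lim0 : inner (Q x + c) d + t * (2^-1 * inner d (Q d)) @[t --> 0^']
    --> inner (Q x + c) d + 0 * (2^-1 * inner d (Q d)).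
  by apply: cvgD; [exact: cvg_cst|apply: cvgM => //; exact: cvg_cst].
by rewrite mul0r addr0 in lim0.
Unshelve. all: by end_near. Qed.

Context {x p : X} {u : U} (fx : subdiff f x p) (gx : subdiff g (L x) u).
Context (kkt : p + Ladj u + (Q x + c) = 0).

Let inner_kkt y : inner y p = - inner y (Ladj u) - inner y (Q x + c).
Proof.
have := congr1 (inner y) kkt; by rewrite (form0r inner_form) !innerE; lra.
Qed.

Lemma primal_optimal : argmin (primal f g L Q c) x.
Proof.
move=> y; rewrite /primal.
have [fF gF] := (subdiff_fin f_proper fx, subdiff_fin g_proper gx).
have := leeD (leeD (fx y) (gx (L y))) (lexx (quadratic Q c y)%:E).
apply: le_trans; rewrite fF gF -!EFinD lee_fin.
have -> : quadratic Q c y = quadratic Q c (x + (y - x)) by rewrite addrC subrK.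
rewrite quadraticD inner_kkt -linearB L_adj.
have := Q_ge0 (y - x); lra.
Qed.

Lemma smooth_subdiff :
  subdiff (fun y => f y + (quadratic Q c y)%:E)%E x (- Ladj u).
Proof.
move=> y; have := leeD (fx y) (lexx (quadratic Q c y)%:E).
apply: le_trans; rewrite (subdiff_fin f_proper fx) -!EFinD lee_fin.
have -> : quadratic Q c y = quadratic Q c (x + (y - x)) by rewrite addrC subrK.
rewrite quadraticD inner_kkt (formNr inner_form).
have := Q_ge0 (y - x); lra.
Qed.

(** At a pair satisfying the optimality system both Fenchel-Young inequalities
    are equalities, and their sum bounds the dual objective from below by its
    value at u. *)
Lemma dual_optimal : argmin (dual f g Ladj Q c) u.
Proof.
move=> v; rewrite /dual.
have gF := subdiff_fin g_proper gx.
have fhF : (f x + (quadratic Q c x)%:E =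
    (fine (f x + (quadratic Q c x)%:E))%:E)%E.
  by rewrite (subdiff_fin f_proper fx).
rewrite (conjugateE fhF smooth_subdiff) (conjugateE gF gx).
have := leeD (conjugate_ge (fun y => f y + (quadratic Q c y)%:E)%E x (- Ladj v))
  (conjugate_ge g (L x) v).
apply: le_trans; rewrite fhF gF -!EFinD lee_fin !(formNr inner_form) !L_adj; lra.
Qed.

End optimality.

(** * Convergence of both algorithms *)

Section proximity_operators.
Context {R : realType} {X : hilbertType R} {phi : X -> \bar R} {p0 v0 : X}.
Context (phi_Gamma0 : Gamma0 phi) (phi_p0 : subdiff phi p0 v0).
Context {t : R} (t_gt0 : 0 < t).

Let phi_proper : Defs.proper phi. Proof. by case: phi_Gamma0. Qed.

Lemma prox_firm :
  firmly_nonexpansive (@inner R X) (prox (fun y => t%:E * phi y)%E).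
Proof.
move=> a b.
have := subdiff_monotone phi_proper (prox_subdiff a phi_Gamma0 phi_p0 t_gt0)
  (prox_subdiff b phi_Gamma0 phi_p0 t_gt0).
by rewrite -scalerBr (formZr inner_form) pmulr_rge0 ?invr_gt0// subBB.
Qed.

Lemma prox_conjugate_firm :
  firmly_nonexpansive (@inner R X) (prox (fun u => t%:E * conjugate phi u)%E).
Proof.
move=> a b.
have := subdiff_monotone phi_proper
  (prox_conjugate_subdiff a phi_Gamma0 phi_p0 t_gt0)
  (prox_conjugate_subdiff b phi_Gamma0 phi_p0 t_gt0).
rewrite -scalerBr (formZl inner_form) pmulr_rge0 ?invr_gt0// subBB.
by rewrite innerC.
Qed.

End proximity_operators.

Theorem theorem8p4 (R : realType) (X U : hilbertType R)
  (f : X -> \bar R) (g : U -> \bar R)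
  (L : {linear X -> U}) (Ladj : U -> X) (Q : {linear X -> X}) (c : X)
  (hf : Gamma0 f) (hg : Gamma0 g)
  (L_bounded : continuous L) (L_adj : is_adjoint L Ladj)
  (Q_bounded : continuous Q) (Q_selfadj : is_adjoint Q Q)
  (Q_pos : forall x, 0 <= inner x (Q x)) (Q_neq0 : exists x, Q x != 0)
  (standing : exists x p q v,
     [/\ subdiff f x p, subdiff g (L x) q, is_gradient (quadratic Q c) x v
       & 0 = p + Ladj q + v])
  (s0 : X) (u0 : U) (tau sigma : R) (rho : nat -> R)
  (htau : 0 < tau < 2 / opnorm Q) (hsigma : 0 < sigma)
  (hsigmatau : sigma * tau * opnorm L ^+ 2 < 1)
  (hrho : forall i, 0 <= rho i <= 2)
  (hrho_sum : (\sum_(0 <= i <oo) (rho i * (2 - rho i))%:E)%E = +oo%E)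
  (s xh : nat -> X) (u uh : nat -> U)
  (hs0 : s 0%N = s0) (hu0 : u 0%N = u0)
  (hiter :
     (exists sh : nat -> X, formI f g L Ladj Q c tau sigma rho s xh sh u uh) \/
     (exists yh : nat -> X, formII f g L Ladj Q c tau sigma rho s xh yh u uh)) :
  (exists xsol : X, argmin (primal f g L Q c) xsol /\ weak_cvg xh xsol) /\
  (exists usol : U, argmin (dual f g Ladj Q c) usol /\ weak_cvg u usol).
Proof.
have [x0 [p0 [q0 [v0 [fx0 gx0 gr]]]]] := standing.
rewrite (gradient_quadratic Q_selfadj gr) => kkt0.
have [tau0 tauQ] := andP htau.
have [_ f_pr _] := hf; have [_ g_pr _] := hg.
have Q0 : 0 <= opnorm Q by exact: opnorm_ge0.
have L0 : 0 <= opnorm L by exact: opnorm_ge0.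
pose Ladj' : {linear U -> X} :=
  HB.pack Ladj (GRing.isLinear.Build R U X *:%R Ladj (adjoint_linear L_adj)).
pose M : {linear X -> X} := (tau / 2) \*: Q.
pose K : {linear U -> X} := tau \*: Ladj'.
pose Lam : {linear X -> U} := sigma \*: L.
pose Pf w := prox (fun x => tau%:E * f x)%E (w - tau *: c).
pose Pg := prox (fun v => sigma%:E * conjugate g v)%E.
pose kappa := tau / sigma.
have ME x : M x = (tau / 2) *: Q x by [].
have KE v : K v = tau *: Ladj v by [].
have LamE x : Lam x = sigma *: L x by [].
have M_adj : is_adjoint M M by move=> x y; rewrite !ME !innerE Q_selfadj.
have M_ge0 x : 0 <= inner x (M x).
  by rewrite ME innerE mulr_ge0// divr_ge0// ltW.
have q01 : 0 <= tau / 2 * opnorm Q < 1.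
  rewrite mulr_ge0 ?divr_ge0 ?(ltW tau0)//=.
  have Qp : 0 < opnorm Q.
    rewrite lt_neqAle Q0 andbT; apply: contraTneq tauQ => <-.
    by rewrite invr0 mulr0 -leNgt ltW.
  by move: tauQ; rewrite ltr_pdivlMr// => tauQ; lra.
have M_le x : `|M x| <= tau / 2 * opnorm Q * `|x|.
  rewrite ME normrZ gtr0_norm ?divr_gt0// -(mulrA (tau / 2)) ler_wpM2l ?divr_ge0 ?(ltW tau0)//.
  exact: (opnorm_ge x Q_bounded).
have kappa0 : 0 < kappa by rewrite divr_gt0.
have Lam_adj x v : kappa * inner (Lam x) v = inner x (K v).
  rewrite LamE KE !innerE L_adj mulrA /kappa divfK// gt_eqF//.
have k0 : 0 <= tau * opnorm L by rewrite mulr_ge0// ltW.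
have K_le v : `|K v| <= tau * opnorm L * `|v|.
  rewrite KE normrZ gtr0_norm// -mulrA ler_wpM2l ?(ltW tau0)//.
  by apply: (adjoint_le v L_adj L0) => x; exact: (opnorm_ge x L_bounded).
have kk : (tau * opnorm L) ^+ 2 < kappa.
  rewrite /kappa ltr_pdivlMr//.
  have -> : (tau * opnorm L) ^+ 2 * sigma =
    tau * (sigma * tau * opnorm L ^+ 2) by ring.
  by rewrite gtr_pMr.
have Pf_firm : firmly_nonexpansive (@inner R X) Pf.
  move=> a b; have := prox_firm hf fx0 tau0 (a - tau *: c) (b - tau *: c).
  by rewrite opprD addrACA subrr addr0.
have Pg_firm := prox_conjugate_firm hg gx0 hsigma.
have solution x v : @saddle R X U M K Lam Pf Pg x v ->
    argmin (primal f g L Q c) x /\ argmin (dual f g Ladj Q c) v.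
  move=> [xE vE].
  have := prox_subdiff (x - K v - 2 *: M x - tau *: c) hf fx0 tau0.
  rewrite /= -/(Pf _) xE => fx.
  have := prox_conjugate_subdiff (v + Lam x) hg gx0 hsigma.
  rewrite /= -/Pg vE => gx.
  have kkt : tau^-1 *: (x - K v - 2 *: M x - tau *: c - x) + Ladj v + (Q x + c)
      = 0.
    apply: inner_inj => y; rewrite KE ME !innerE (form0l inner_form).
    by field; rewrite gt_eqF.
  rewrite (addrC v) addrK scalerA mulVf ?scale1r ?gt_eqF// in gx.
  split; first exact (primal_optimal f_pr g_pr L_adj Q_selfadj Q_pos fx gx kkt).
  exact (dual_optimal f_pr g_pr L_adj Q_selfadj Q_pos fx gx kkt).
have saddle0 : @saddle R X U M K Lam Pf Pg x0 q0.
  split; last exact: prox_conjugateE g_pr hsigma gx0.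
  rewrite -[RHS](prox_eq f_pr tau0 fx0) /Pf; congr (prox _ _).
  apply: inner_inj => y; have := congr1 (inner^~ y) kkt0.
  by rewrite KE ME !innerE (form0l inner_form); nra.
suff [x [v [sxv xx uv]]] : exists x v, [/\ @saddle R X U M K Lam Pf Pg x v,
    weak_cvg xh x & weak_cvg u v].
  by have [? ?] := solution _ _ sxv; split; [exists x|exists v].
pose z i : X * U := (s i, u i).
case: hiter => [[sh it]|[yh it]].
  have xhE i : xh i = primal_first (M := M) (Pf := Pf) (s i) by case: (it i).
  have zS i : z i.+1 = z i + rho i *:
      (@step_primal_first R X U M K Lam Pf Pg (z i) - z i).
    have [xE uE shE sE uSE] := it i.
    have -> : @step_primal_first R X U M K Lam Pf Pg (z i) = (sh i, uh i).
      rewrite /step_primal_first /= -xhE (_ : Pg _ = uh i); last exact/esym.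
      by rewrite shE.
    by rewrite /z sE uSE.
  have [x [v [sxv xx uv]]] := primal_first_cvg M_adj M_ge0 q01 M_le kappa0
    Lam_adj k0 K_le kk Pf_firm Pg_firm hrho hrho_sum saddle0 zS.
  exists x, v; split=> //.
  by rewrite (_ : xh = fun n => primal_first (M := M) (Pf := Pf) (s n))//; exact/funext.
pose v i := @dual_first R X U M K Lam Pg (z i).
have uhE i : uh i = v i by case: (it i).
have yhE i : yh i = (z i).1 - M (z i).1 - K (v i).
  by rewrite -uhE; case: (it i).
have stepE i : @step_dual_first R X U M K Lam Pf Pg (z i) =
    (s i + (xh i - yh i), uh i).
  rewrite yhE uhE /step_dual_first -/(v i) -yhE.
  by congr (_ + (_ - _), _); case: (it i) => _ _ ->.
have zS i : z i.+1 = z i + rho i *: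
    (@step_dual_first R X U M K Lam Pf Pg (z i) - z i).
  have [_ _ _ sE uSE] := it i.
  have dE : xh i - yh i = s i + (xh i - yh i) - s i by rewrite [RHS]addrC addKr.
  by rewrite dE in sE; rewrite stepE /z sE uSE.
have xhE i : (@step_dual_first R X U M K Lam Pf Pg (z i)).1 =
    (z i).1 + (xh i - ((z i).1 - M (z i).1 - K (v i))).
  by rewrite stepE yhE.
exact (dual_first_cvg M_adj M_ge0 q01 M_le kappa0
  Lam_adj k0 K_le kk Pf_firm Pg_firm hrho hrho_sum saddle0 zS xhE).
Qed.
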